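(* (a) The cycle graph $C_4$ is RA but not strongly RA. (b) An $m\times k$ grid graph with $m\ge 2$ and $k\ge 3$ is strongly RA. (c) For integers $m,n\ge 1$ with $(m,n)\neq(1,1)$, the complete bipartite graph $K_{m,n}$ is RA, and it is strongly RA if and only if $m$ and $n$ are relatively prime.
   Context: Graphs are finite, undirected, simple. For a group $G$ and a graph $\Gamma$ with vertices $v_1,\dots,v_n$, $n=|\Gamma|$, and for $g\in G$ and a vertex $v$, let $g^v\in G^n$ be the element with $g$ in each coordinate corresponding to a vertex of the closed neighborhood of $v$ and the identity in all other coordinates. The graph power $G^\Gamma$ is the subgroup of $G^n$ generated by all $g^v$. Commutators are $[x,y]=xyx^{-1}y^{-1}$ and $[G,G]$ is the commutator subgroup. $\Gamma$ is RA if $[G,G]^{|\Gamma|}\le G^\Gamma$ for every group $G$. Let $\mathrm{Comm}_d(G,\Gamma)$ be the subgroup of $[G^\Gamma,G^\Gamma]$ generated by all $[g^u,h^v]$ with $g,h\in G$ and distinct vertices $u\neq v$ of $\Gamma$. $\Gamma$ is strongly RA if $\mathrm{Comm}_d(G,\Gamma)=[G,G]^{|\Gamma|}$ for every group $G$. *)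

(* Defs.v *)
From HB Require Import structures.
From mathcomp Require Import all_boot.
From mathcomp Require Import boolp classical_sets.

Set Implicit Arguments.
Unset Strict Implicit.
Unset Printing Implicit Defensive.

Local Open Scope classical_set_scope.

Record sgraph := SGraph {
  vertex :> finType;
  adj : rel vertex;
  adj_sym : symmetric adj;
  adj_irrefl : irreflexive adj }.

Arguments adj {s}.

Definition cycle_adj (n : nat) : rel 'I_n :=
  fun i j => (i != j) && ((j == ordS i) || (i == ordS j)).

Lemma cycle_adj_sym n : symmetric (@cycle_adj n).
Proof. by move=> i j; rewrite /cycle_adj eq_sym orbC. Qed.

Lemma cycle_adj_irrefl n : irreflexive (@cycle_adj n).
Proof. by move=> i; rewrite /cycle_adj eqxx. Qed.

(* This is the usual cycle C_n for n >= 3; for n <= 2 it is complete. *)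
Definition cycle_graph (n : nat) : sgraph :=
  SGraph (@cycle_adj_sym n) (@cycle_adj_irrefl n).

Definition consecutive (i j : nat) : bool := (i.+1 == j) || (j.+1 == i).

Definition grid_adj (m k : nat) : rel ('I_m * 'I_k) :=
  fun u v => ((u.1 == v.1) && consecutive u.2 v.2)
          || ((u.2 == v.2) && consecutive u.1 v.1).

Lemma grid_adj_sym m k : symmetric (@grid_adj m k).
Proof.
have consecC i j : consecutive i j = consecutive j i by rewrite /consecutive orbC.
move=> u v; rewrite /grid_adj (eq_sym u.1) (eq_sym u.2).
by rewrite (consecC u.2) (consecC u.1).
Qed.

Lemma grid_adj_irrefl m k : irreflexive (@grid_adj m k).
Proof.
have consecN i : consecutive i i = false by rewrite /consecutive orbb gtn_eqF.
by move=> u; rewrite /grid_adj !consecN !andbF.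
Qed.

Definition grid_graph (m k : nat) : sgraph :=
  SGraph (@grid_adj_sym m k) (@grid_adj_irrefl m k).

Definition bipartite_adj (m n : nat) : rel ('I_m + 'I_n) :=
  fun u v => match u, v with
             | inl _, inr _ | inr _, inl _ => true
             | _, _ => false
             end.

Lemma bipartite_adj_sym m n : symmetric (@bipartite_adj m n).
Proof. by move=> [i|i] [j|j]. Qed.

Lemma bipartite_adj_irrefl m n : irreflexive (@bipartite_adj m n).
Proof. by move=> [i|i]. Qed.

Definition complete_bipartite (m n : nat) : sgraph :=
  SGraph (@bipartite_adj_sym m n) (@bipartite_adj_irrefl m n).

(* [groupType] (unlike [finGroupType]) allows infinite groups; subgroups of G
   are represented as [set G]. *)

Definition is_subgroup (G : groupType) (H : set G) : Prop :=
  [/\ H 1%g, forall x y, H x -> H y -> H (x * y)%g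
    & forall x, H x -> H (x^-1)%g].

Definition generated (G : groupType) (S : set G) : set G :=
  smallest (@is_subgroup G) S.

(* The library's [~ x, y] is x^-1 y^-1 x y; here the inverses are on the right. *)
Definition rcommg (G : groupType) (x y : G) : G := (x * y * x^-1 * y^-1)%g.

Definition derived_subgroup (G : groupType) : set G :=
  generated [set rcommg x y | x in setT & y in setT].

(* The group G^|Gamma| is {ffun Gamma -> G}, with coordinates indexed directly
   by the vertices and the pointwise group structure. *)
Definition derived_power (G : groupType) (Gamma : sgraph) :
    set {ffun Gamma -> G} :=
  [set f | forall v, derived_subgroup (f v)].

Definition vertex_elt (G : groupType) (Gamma : sgraph) (g : G) (v : Gamma) :
    {ffun Gamma -> G} :=
  [ffun w => if (w == v) || adj v w then g else 1%g].

Definition graph_power (G : groupType) (Gamma : sgraph) :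
    set {ffun Gamma -> G} :=
  generated [set vertex_elt g v | g in setT & v in setT].

Definition RA (Gamma : sgraph) : Prop :=
  forall G : groupType, @derived_power G Gamma `<=` @graph_power G Gamma.

Definition Comm_d (G : groupType) (Gamma : sgraph) : set {ffun Gamma -> G} :=
  generated [set f | exists (g h : G) (u v : Gamma),
    u != v /\ f = rcommg (vertex_elt g u) (vertex_elt h v)].

Definition strongly_RA (Gamma : sgraph) : Prop :=
  forall G : groupType, @Comm_d G Gamma = @derived_power G Gamma.

(* Main.v *)
From HB Require Import structures.
Require Import Defs.
From mathcomp Require Import classical_sets.
From mathcomp Require Import all_boot all_algebra.
From mathcomp Require Import ring zify.

(** Write N[u] for the closed neighbourhood of u, and c^a, for c in G and an
integer vector a indexed by the vertices, for the element of the power of G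
with coordinates c ^ (a v).  Since g^u is constant on N[u], the commutator
[g^u, h^v] is the constant [g, h] on N[u] :&: N[v]: Comm_d depends on the graph
only through these intersections.

For a fixed c and a fixed subgroup H, the integer vectors a with c^a in H form
a subgroup of Z^V.  So if the indicators of the sets N[u] :&: N[v], u != v,
generate Z^V, then for c in [G, G] every coordinate copy of c lies in Comm_d,
and the graph is strongly RA ([strongly_RA_of_span]).  If u = v is allowed, the
same argument takes place in G^Gamma and yields RA ([RA_of_span]).

Conversely, let w be an integer weight on the vertices and d an integer that
divides the total weight of every N[u] :&: N[v], u != v, but not the weight of
some vertex.  In the integer Heisenberg group the commutator subgroup is an
infinite cyclic central subgroup, so f |-> sum_v w(v) f(v) mod d is a
homomorphism on the power of that subgroup; it kills Comm_d but not the whole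
power, and the graph is not strongly RA ([not_strongly_RA_of_weight]).

It remains to look at the intersections.
- In a grid, two adjacent vertices give the edge between them and the vertices
  0 and 2 of a row give the singleton of the vertex 1; differences along the
  row then give all its singletons.
- In K_{m,n}, the intersections are all edges, and each side as soon as the
  other side has two vertices.  Modulo the edges, all left vertices are equal
  to some x and all right vertices to -x, and the sides say that m x and n x
  vanish.  If m and n are coprime then x vanishes; otherwise the weights +1
  on the left and -1 on the right, with d = gcd(m, n), are an obstruction.
  Adding the sets N[u] themselves isolates a vertex as the difference of N[u]
  and a side, hence RA.
- In C_4 all intersections for u != v have two elements, so constant weight 1
  with d = 2 is an obstruction; N[v+1] minus N[v+1] :&: N[v+2] is {v}, hence
  RA. *)

Set Implicit Arguments.
Unset Strict Implicit.
Unset Printing Implicit Defensive.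

Import GRing.Theory.

(** * Generated subgroups *)

Section Generated.
Variable G : groupType.

Lemma generated_subgroup (S : set G) : is_subgroup (generated S).
Proof.
split=> [M [[M1 _ _] _] //|x y Sx Sy M MP|x Sx M MP].
- by case: (MP) => -[_ MM _] _; apply: MM; [apply: Sx|apply: Sy].
- by case: (MP) => -[_ _ MV] _; apply: MV; apply: Sx.
Qed.

Lemma mem_generated (S : set G) x : S x -> generated S x.
Proof. by move=> Sx M [_ SM]; apply: SM. Qed.

Lemma generated_min (S H : set G) :
  is_subgroup H -> (forall x, S x -> H x) -> forall x, generated S x -> H x.
Proof. by move=> gH SH x; apply. Qed.

Lemma mem_derived (g h : G) : derived_subgroup (rcommg g h).
Proof. by apply: mem_generated; exists g => //; exists h. Qed.

Lemma derived1 : derived_subgroup (1 : G)%g.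
Proof. by move=> M [[M1 _ _] _]. Qed.

End Generated.

(** * Integer powers along an integer vector *)

Section IntPower.
Local Open Scope group_scope.
Variable G : groupType.
Implicit Types (c : G) (x y : int).

Definition zexpg c x : G :=
  match x with Posz n => c ^+ n | Negz n => c ^- n.+1 end.

Lemma zexpg_natB c (m n : nat) : zexpg c (m%:Z - n%:Z)%R = c ^+ m / c ^+ n.
Proof.
case: (leqP n m) => [le_nm|lt_mn]; first by rewrite subzn //= expgnFr.
have -> : (m%:Z - n%:Z)%R = Negz (n - m).-1 by lia.
by rewrite /= prednK ?subn_gt0 // expgnFr 1?ltnW // invgF.
Qed.

Lemma zexpgB c x y : zexpg c (x - y)%R = zexpg c x / zexpg c y.
Proof.
have natB z : exists p : nat * nat, z = (p.1%:Z - p.2%:Z)%R.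
  by case: z => n; [exists (n, 0)|exists (0, n.+1)] => /=; lia.
have [[a b] ->] := natB x; have [[a' b'] ->] := natB y.
have -> : (a%:Z - b%:Z - (a'%:Z - b'%:Z))%R = ((a + b')%N%:Z - (a' + b)%N%:Z)%R.
  by lia.
have cV : commute (c ^+ b') (c ^+ b)^-1 by apply/commuteV/commuteX2.
by rewrite !zexpg_natB invgF !expgnDr invgM -!mulgA (mulgA _ _ (c ^+ a')^-1) cV !mulgA.
Qed.

Definition vexpg (V : finType) c (a : {ffun V -> int}) : {ffun V -> G} :=
  [ffun v => zexpg c (a v)].

Definition constant_on (V : finType) c (S : {set V}) : {ffun V -> G} :=
  [ffun v => if v \in S then c else 1].

Lemma constant_onM (V : finType) c d (S : {set V}) :
  constant_on (c * d) S = constant_on c S * constant_on d S.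
Proof. by apply/ffunP=> v; rewrite !ffunE; case: ifP; rewrite ?mulg1. Qed.

Lemma constant_onV (V : finType) c (S : {set V}) :
  constant_on c^-1 S = (constant_on c S)^-1.
Proof. by apply/ffunP=> v; rewrite !ffunE; case: ifP; rewrite ?invg1. Qed.

Lemma constant_on1 (V : finType) (S : {set V}) : constant_on 1 S = 1.
Proof. by apply/ffunP=> v; rewrite !ffunE if_same. Qed.

End IntPower.

(** * Integer combinations of indicators *)

Section Span.
Local Open Scope ring_scope.
Variable V : finType.
Implicit Types (S T : {set V}) (a b : {ffun V -> int}).

Definition indic S : {ffun V -> int} := [ffun v => (v \in S)%:Z].

Inductive int_span (P : {set V} -> Prop) : {ffun V -> int} -> Prop :=
| span_indic S of P S : int_span P (indic S)
| span0 : int_span P 0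
| spanB a b of int_span P a & int_span P b : int_span P (a - b).

Variable P : {set V} -> Prop.

Lemma spanN a : int_span P a -> int_span P (- a).
Proof. by move=> Pa; rewrite -sub0r; apply: spanB => //; apply: span0. Qed.

Lemma spanD a b : int_span P a -> int_span P b -> int_span P (a + b).
Proof. by move=> Pa /spanN Pb; rewrite -(opprK b); apply: spanB. Qed.

Lemma span_sum (I : finType) (F : I -> {ffun V -> int}) :
  (forall i, int_span P (F i)) -> int_span P (\sum_i F i).
Proof.
move=> PF; elim/big_ind: _ => //; [exact: span0|exact: spanD].
Qed.

Lemma spanMn a n : int_span P a -> int_span P (a *+ n).
Proof.
move=> Pa; rewrite -[n]card_ord -sumr_const.
by apply: span_sum.
Qed.

(** Bezout: a is an integer combination of a *+ m and a *+ n. *)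
Lemma span_coprime a m n : (0 < m)%N -> coprime m n ->
  int_span P (a *+ m) -> int_span P (a *+ n) -> int_span P a.
Proof.
move=> m_gt0 /eqP co_mn Pm Pn; have [k _] := Bezoutl n m_gt0.
rewrite co_mn => /dvdnP[l Ekl].
have -> : a = a *+ m *+ l - a *+ n *+ k.
  by rewrite -!mulrnA (mulnC m) (mulnC n) -Ekl mulrnDr mulr1n addrK.
by apply: spanB; apply: spanMn.
Qed.

Lemma indicD S T : T \subset S -> indic S = indic T + indic (S :\: T).
Proof.
move=> /subsetP sTS; apply/ffunP=> v; rewrite !ffunE inE.
by have := sTS v; case: (v \in S); case: (v \in T) => // ->.
Qed.

Lemma indic_sum S : indic S = \sum_(v in S) indic [set v].
Proof.
apply/ffunP=> v; rewrite sum_ffunE ffunE.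
under eq_bigr => u _ do rewrite ffunE inE eq_sym.
case: (boolP (v \in S)) => vS; last first.
  by rewrite big1 // => u uS; case: eqP uS vS => // -> ->.
by rewrite (bigD1 v) //= eqxx big1 ?addr0 // => u /andP[_ /negPf->].
Qed.

Lemma span_setD S T :
  int_span P (indic S) -> int_span P (indic T) -> T \subset S ->
  int_span P (indic (S :\: T)).
Proof.
move=> PS PT /indicD ES.
have -> : indic (S :\: T) = indic S - indic T by rewrite ES addrC addKr.
exact: spanB.
Qed.

Lemma indic_pair u v : u != v ->
  indic [set u; v] = indic [set u] + indic [set v].
Proof.
move=> neq_uv; apply/ffunP=> w; rewrite !ffunE !inE.
case: (eqVneq w u) => [->|_] /=; first by rewrite (negPf neq_uv).
by rewrite add0r.
Qed.

Lemma span_pair u v : u != v ->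
  int_span P (indic [set u; v]) -> int_span P (indic [set u]) ->
  int_span P (indic [set v]).
Proof.
move=> /indic_pair Euv Puv Pu.
by rewrite -(addKr (indic [set u]) (indic [set v])) -Euv addrC; apply: spanB.
Qed.

Definition spans := forall v, int_span P (indic [set v]).

End Span.

(** * From spanning intersections to the derived power *)

Section Spanning.
Local Open Scope group_scope.
Variables (Gamma : sgraph) (P : {set Gamma} -> Prop).

(** The exponent vectors a with c^a in H form a subgroup. *)
Lemma vexpg_span (G : groupType) (H : set {ffun Gamma -> G}) c :
  is_subgroup H -> (forall S, P S -> H (constant_on c S)) ->
  forall a, int_span P a -> H (vexpg c a).
Proof.
case=> H1 HM HV HS a; elim=> [S PS||{}a b _ Ha _ Hb].
- have -> : vexpg c (indic S) = constant_on c S.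
    by apply/ffunP=> v; rewrite !ffunE; case: ifP.
  exact: HS.
- have -> // : vexpg c 0%R = 1 :> {ffun Gamma -> G}.
  by apply/ffunP=> v; rewrite !ffunE.
- have -> : vexpg c (a - b)%R = vexpg c a * (vexpg c b)^-1.
    by apply/ffunP=> v; rewrite !ffunE zexpgB.
  by apply: HM => //; apply: HV.
Qed.

(** An element of the derived power is the product of its coordinates, so it
is enough that H contains the coordinate copies of the derived subgroup. *)
Lemma derived_power_span (G : groupType) (H : set {ffun Gamma -> G}) :
  is_subgroup H -> spans P ->
  (forall S g h, P S -> H (constant_on (rcommg g h) S)) ->
  forall f, @derived_power G Gamma f -> H f.
Proof.
move=> gH spanP Hcomm f f_der; have [H1 HM HV] := gH.
have H_const c S : derived_subgroup c -> P S -> H (constant_on c S).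
  move=> Gc PS; pattern c; apply: generated_min Gc; last first.
    by move=> _ [g _ [h _ <-]]; apply: Hcomm.
  split=> [|x y Hx Hy|x Hx].
  - by rewrite constant_on1.
  - by rewrite constant_onM; apply: HM.
  - by rewrite constant_onV; apply: HV.
have H_coord c v : derived_subgroup c -> H (constant_on c [set v]).
  move=> Gc.
  have -> : constant_on c [set v] = vexpg c (indic [set v]).
    by apply/ffunP=> u; rewrite !ffunE; case: ifP.
  by apply: vexpg_span (spanP v) => // S; apply: H_const.
suff H_part s : uniq s -> H [ffun v => if v \in s then f v else 1].
  have -> : f = [ffun v => if v \in enum Gamma then f v else 1].
    by apply/ffunP=> v; rewrite ffunE mem_enum.
  exact: H_part (enum_uniq Gamma).
elim: s => [_|u s IHs /= /andP[u_s /IHs Hs]].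
  have -> // : [ffun v => if v \in [::] then f v else 1] = 1.
  by apply/ffunP=> v; rewrite !ffunE.
have -> : [ffun v => if v \in u :: s then f v else 1] =
    constant_on (f u) [set u] * [ffun v => if v \in s then f v else 1].
  apply/ffunP=> v; rewrite !ffunE inE in_cons; case: eqVneq => [->|_] /=.
    by rewrite (negPf u_s) mulg1.
  by rewrite mul1g.
exact: HM (H_coord _ u (f_der u)) Hs.
Qed.

End Spanning.

(** * Closed neighbourhoods and the two criteria *)

Section Criteria.
Variable Gamma : sgraph.

Definition nbhd (u : Gamma) : {set Gamma} := [set w | (w == u) || adj u w].

Definition meet (S : {set Gamma}) := exists u v, S = nbhd u :&: nbhd v.

Definition distinct_meet (S : {set Gamma}) :=
  exists u v, u != v /\ S = nbhd u :&: nbhd v.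

Lemma vertex_eltE (G : groupType) (g : G) v :
  vertex_elt g v = constant_on g (nbhd v).
Proof. by apply/ffunP=> w; rewrite !ffunE inE. Qed.

Lemma rcommg_vertex_elt (G : groupType) (g h : G) (u v : Gamma) :
  rcommg (vertex_elt g u) (vertex_elt h v) =
  constant_on (rcommg g h) (nbhd u :&: nbhd v).
Proof.
rewrite !vertex_eltE; apply/ffunP=> w; rewrite !ffunE in_setI /rcommg.
by case: (w \in nbhd u); case: (w \in nbhd v);
  rewrite /= ?(invg1, mulg1, mul1g, mulgV).
Qed.

Theorem RA_of_span : spans meet -> RA Gamma.
Proof.
move=> span_meet G f.
have gGP : is_subgroup (@graph_power G Gamma) by apply: generated_subgroup.
have [_ gM gV] := gGP.
have mem_vertex (g : G) (v : Gamma) : graph_power (vertex_elt g v).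
  by apply: mem_generated; exists g => //; exists v.
apply: (derived_power_span gGP span_meet) => S g h [u [v ->]].
rewrite -rcommg_vertex_elt.
have gg := gM _ _ (mem_vertex g u) (mem_vertex h v).
exact: gM (gM _ _ gg (gV _ (mem_vertex g u))) (gV _ (mem_vertex h v)).
Qed.

Lemma Comm_d_sub_derived_power (G : groupType) (f : {ffun Gamma -> G}) :
  Comm_d f -> derived_power f.
Proof.
move: f; apply: generated_min.
  have [der1 derM derV] : is_subgroup (@derived_subgroup G).
    exact: generated_subgroup.
  split=> [v|f g Df Dg v|f Df v]; rewrite ffunE.
  - exact: der1.
  - by apply: derM.
  - by apply: derV.
move=> _ [g [h [u [v [_ ->]]]]] w; rewrite rcommg_vertex_elt ffunE.
by case: ifP => _; [apply: mem_derived|apply: derived1].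
Qed.

Theorem strongly_RA_of_span : spans distinct_meet -> strongly_RA Gamma.
Proof.
move=> span_meet G; apply/seteqP; split=> f; first exact: Comm_d_sub_derived_power.
apply: (derived_power_span (generated_subgroup _) span_meet).
move=> S g h [u [v [neq_uv ->]]]; apply: mem_generated.
by exists g, h, u, v; rewrite rcommg_vertex_elt.
Qed.

End Criteria.

(** * The weight obstruction *)

Section Heisenberg.
Local Open Scope ring_scope.

(** The triple (a, b, c) is the upper unitriangular matrix with a and b above
the diagonal and c in the corner. *)
Definition heis := (int * int * int)%type.

HB.instance Definition _ := Choice.on heis.

Definition heis_mul (x y : heis) : heis :=
  (x.1.1 + y.1.1, x.1.2 + y.1.2, x.2 + y.2 + x.1.1 * y.1.2).

Definition heis_inv (x : heis) : heis :=
  (- x.1.1, - x.1.2, - x.2 + x.1.1 * x.1.2).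

Definition heis_one : heis := (0, 0, 0).

Lemma heis_mulA : associative heis_mul.
Proof.
by move=> [[a b] c] [[a' b'] c'] [[a'' b''] c'']; congr (_, _, _) => /=; ring.
Qed.

Lemma heis_mul1g : left_id heis_one heis_mul.
Proof. by move=> [[a b] c]; congr (_, _, _) => /=; ring. Qed.

Lemma heis_mulg1 : right_id heis_one heis_mul.
Proof. by move=> [[a b] c]; congr (_, _, _) => /=; ring. Qed.

Lemma heis_mulVg : left_inverse heis_one heis_inv heis_mul.
Proof. by move=> [[a b] c]; congr (_, _, _) => /=; ring. Qed.

Lemma heis_mulgV : right_inverse heis_one heis_inv heis_mul.
Proof. by move=> [[a b] c]; congr (_, _, _) => /=; ring. Qed.

HB.instance Definition _ := isGroup.Build heis
  heis_mulA heis_mul1g heis_mulg1 heis_mulVg heis_mulgV.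

Lemma rcommg_heis (x y : heis) :
  rcommg x y = (0, 0, x.1.1 * y.1.2 - y.1.1 * x.1.2) :> heis.
Proof.
by case: x y => [[a b] c] [[a' b'] c']; congr (_, _, _) => /=; ring.
Qed.

(** On elements with central coordinates the weighted sum of the corner entries
is additive, and it maps the constant c on S to c times the weight of S. *)
Theorem not_strongly_RA_of_weight (Gamma : sgraph) (w : Gamma -> int) (d : int)
    (v0 : Gamma) :
  (forall S, distinct_meet S -> (d %| \sum_(v in S) w v)%Z) ->
  ~~ (d %| w v0)%Z -> ~ strongly_RA Gamma.
Proof.
move=> wS wv0 /(_ heis) eq_comm.
pose wsum (f : {ffun Gamma -> heis}) := \sum_v w v * (f v).2.
have wsum_const c S :
    wsum (constant_on ((0, 0, c) : heis) S) = (\sum_(v in S) w v) * c.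
  rewrite mulr_suml [RHS]big_mkcond; apply: eq_bigr => v _.
  by rewrite ffunE; case: ifP => //= _; rewrite mulr0.
(* The vanishing of the first two entries makes wsum additive on K. *)
pose K : set {ffun Gamma -> heis} :=
  fun f => (forall v, (f v).1 = (0, 0)) /\ (d %| wsum f)%Z.
have gK : is_subgroup K.
  split=> [|f g [f0 df] [g0 dg]|f [f0 df]]; split.
  - by move=> v; rewrite ffunE.
  - by rewrite /wsum big1 ?dvdz0 // => v _; rewrite ffunE mulr0.
  - by move=> v; rewrite ffunE /= f0 g0.
  - have -> : wsum (f * g)%g = wsum f + wsum g.
      rewrite -big_split; apply: eq_bigr => v _.
      by rewrite ffunE /= f0 /=; ring.
    exact: rpredD.
  - by move=> v; rewrite ffunE /= f0.
  - have -> : wsum (f^-1)%g = - wsum f.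
      rewrite -sumrN; apply: eq_bigr => v _.
      by rewrite ffunE /= f0 /=; ring.
    by rewrite rpredN.
have sub_K f : Comm_d f -> K f.
  move: f; apply: generated_min gK _ => _ [g [h [u [v [neq_uv ->]]]]].
  rewrite rcommg_vertex_elt rcommg_heis; split=> [x|].
    by rewrite ffunE; case: ifP.
  by rewrite wsum_const dvdz_mulr //; apply: wS; exists u, v.
pose f0 := constant_on ((0, 0, 1) : heis) [set v0].
have f0_der : derived_power f0.
  have -> : f0 = constant_on (rcommg ((1, 0, 0) : heis) (0, 1, 0)) [set v0].
    by rewrite rcommg_heis.
  move=> v; rewrite ffunE; case: ifP => _; first exact: mem_derived.
  exact: derived1.
have := f0_der; rewrite -eq_comm => /sub_K[_].
by rewrite wsum_const big_set1 mulr1 (negPf wv0).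
Qed.

End Heisenberg.

(** * Graph families *)

Section Span_nbhd.
Variable Gamma : sgraph.

Lemma span_nbhdI (u v : Gamma) : u != v ->
  int_span (@distinct_meet Gamma) (indic (nbhd u :&: nbhd v)).
Proof. by move=> neq_uv; apply: span_indic; exists u, v. Qed.

Lemma span_meetI (u v : Gamma) :
  int_span (@meet Gamma) (indic (nbhd u :&: nbhd v)).
Proof. by apply: span_indic; exists u, v. Qed.

(** N[u] :\: N[v] is the difference of N[u] and N[u] :&: N[v]. *)
Lemma span_nbhdD (u v : Gamma) :
  int_span (@meet Gamma) (indic (nbhd u :\: nbhd v)).
Proof.
have -> : nbhd u :\: nbhd v = (nbhd u :&: nbhd u) :\: (nbhd u :&: nbhd v).
  by apply/setP=> w; rewrite !in_setD !in_setI; case: (w \in nbhd u); rewrite ?andbF.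
apply: span_setD; [exact: span_meetI|exact: span_meetI|].
by rewrite setIid subsetIl.
Qed.

End Span_nbhd.

Lemma RA_C4 : RA (cycle_graph 4).
Proof.
apply: RA_of_span => v.
pose N := @nbhd (cycle_graph 4).
have <- : N (ordS v) :\: N (ordS (ordS v)) = [set v].
  apply/setP=> w; rewrite !inE.
  by case: v w => [[|[|[|[|//]]]] ?] [[|[|[|[|//]]]] ?].
exact: span_nbhdD.
Qed.

Lemma not_strongly_RA_C4 : ~ strongly_RA (cycle_graph 4).
Proof.
refine (@not_strongly_RA_of_weight (cycle_graph 4) (fun=> 1%R) 2 ord0 _ _) => //.
move=> S [u [v [neq_uv ->]]].
rewrite sumr_const -sum1_card big_mkcond !big_ord_recl big_ord0 !inE.
by case: u v neq_uv => [[|[|[|[|//]]]] ?] [[|[|[|[|//]]]] ?].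
Qed.

Lemma strongly_RA_grid m k : 3 <= k -> strongly_RA (grid_graph m k).
Proof.
move=> k_ge3; apply: strongly_RA_of_span => -[i j].
have k_gt0 : 0 < k by lia.
have k_gt1 : 1 < k by lia.
pose vtx (l : nat) (lk : l < k) : grid_graph m k := (i, Ordinal lk).
have vtxE l (lk : l < k) (u : grid_graph m k) :
    (u == vtx l lk) = (u.1 == i :> nat) && (u.2 == l :> nat).
  by case: u.
have meet02 : nbhd (vtx 0 k_gt0) :&: nbhd (vtx 2 k_ge3) = [set vtx 1 k_gt1].
  apply/setP=> u; rewrite !inE !vtxE /= /grid_adj /consecutive /= -!val_eqE /=.
  lia.
have meet_edge l (lk : l < k) (l1k : l.+1 < k) :
    nbhd (vtx l lk) :&: nbhd (vtx l.+1 l1k) = [set vtx l lk; vtx l.+1 l1k].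
  apply/setP=> u; rewrite !inE !vtxE /= /grid_adj /consecutive /= -!val_eqE /=.
  lia.
have span_edge l (lk : l < k) (l1k : l.+1 < k) :
    int_span (@distinct_meet _) (indic [set vtx l lk; vtx l.+1 l1k]).
  by rewrite -meet_edge; apply: span_nbhdI; rewrite vtxE /=; lia.
have span1 : int_span (@distinct_meet _) (indic [set vtx 1 k_gt1]).
  by rewrite -meet02; apply: span_nbhdI; rewrite vtxE /=; lia.
have span_row l : forall lk : l < k,
    int_span (@distinct_meet _) (indic [set vtx l lk]).
  elim: l => [|l IHl] lk.
    apply: span_pair span1; first by rewrite vtxE andbF.
    by rewrite setUC; apply: span_edge.
  have l_k : l < k by lia.
  apply: span_pair (IHl l_k); last exact: span_edge.
  by rewrite vtxE /=; lia.
have -> : (i, j) = vtx j (ltn_ord j) by congr (_, _); apply: val_inj.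
exact: span_row.
Qed.

Section Bipartite.
Variables m n : nat.
Let K : sgraph := complete_bipartite m n.
Let l (i : 'I_m) : K := inl i.
Let r (j : 'I_n) : K := inr j.
Let lside : {set K} := [set u | if u is inl _ then true else false].
Let rside : {set K} := [set u | if u is inr _ then true else false].

Lemma nbhd_l i : nbhd (l i) = l i |: rside.
Proof. by apply/setP=> -[i'|j']; rewrite !inE //= orbF. Qed.

Lemma nbhd_r j : nbhd (r j) = r j |: lside.
Proof. by apply/setP=> -[i'|j']; rewrite !inE //= orbF. Qed.

Lemma meet_lr i j : nbhd (l i) :&: nbhd (r j) = [set l i; r j].
Proof.
by apply/setP=> -[i'|j']; rewrite !inE /= ?orbF ?andbT ?orbT.
Qed.

Lemma meet_ll i i' : i != i' -> nbhd (l i) :&: nbhd (l i') = rside.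
Proof.
move=> neq_ii'; rewrite !nbhd_l; apply/setP=> -[k|k]; rewrite !inE //= !orbF.
by apply/negP=> /andP[/eqP-> /eqP[/eqP]]; rewrite (negPf neq_ii').
Qed.

Lemma meet_rr j j' : j != j' -> nbhd (r j) :&: nbhd (r j') = lside.
Proof.
move=> neq_jj'; rewrite !nbhd_r; apply/setP=> -[k|k]; rewrite !inE //= !orbF.
by apply/negP=> /andP[/eqP-> /eqP[/eqP]]; rewrite (negPf neq_jj').
Qed.

Lemma indic_lside : indic lside = (\sum_i indic [set l i])%R.
Proof.
rewrite indic_sum big_mkcond big_sumType /= [X in (_ + X)%R]big1 ?addr0.
  by apply: eq_bigr => i _; rewrite inE.
by move=> j _; rewrite inE.
Qed.

Lemma indic_rside : indic rside = (\sum_j indic [set r j])%R.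
Proof.
rewrite indic_sum big_mkcond big_sumType /= big1 ?add0r.
  by apply: eq_bigr => j _; rewrite inE.
by move=> i _; rewrite inE.
Qed.

(** The side of a vertex u is N[u'] :&: N[u''] for two vertices on the other
side, and N[u] minus the opposite side is {u}. *)
Lemma RA_bipartite : 0 < m -> 0 < n -> (m, n) <> (1, 1) -> RA K.
Proof.
move=> m_gt0 n_gt0 neq11; apply: RA_of_span.
have pair i j : int_span (@meet K) (indic [set l i; r j]).
  by rewrite -meet_lr; apply: span_meetI.
have nbhdS (u : K) : int_span (@meet K) (indic (nbhd u)).
  by rewrite -[nbhd u]setIid; apply: span_meetI.
have [m_gt1|m_le1] := ltnP 1 m.
  have Pr : int_span (@meet K) (indic rside).
    by rewrite -(@meet_ll (Ordinal m_gt0) (Ordinal m_gt1)) //; apply: span_meetI.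
  have Pl i : int_span (@meet K) (indic [set l i]).
    have -> : [set l i] = nbhd (l i) :\: rside.
      by apply/setP=> -[i'|j']; rewrite nbhd_l !inE //= ?orbF ?andbF.
    by apply: span_setD => //; rewrite nbhd_l subsetUr.
  by case=> [i|j]; [exact: Pl|apply: span_pair (Pl (Ordinal m_gt0))].
have n_gt1 : 1 < n.
  by rewrite ltnNge; apply/negP=> n_le1; apply: neq11; congr (_, _); lia.
have Pl : int_span (@meet K) (indic lside).
  by rewrite -(@meet_rr (Ordinal n_gt0) (Ordinal n_gt1)) //; apply: span_meetI.
have Pr j : int_span (@meet K) (indic [set r j]).
  have -> : [set r j] = nbhd (r j) :\: lside.
    by apply/setP=> -[i'|j']; rewrite nbhd_r !inE //= ?orbF ?andbF.
  by apply: span_setD => //; rewrite nbhd_r subsetUr.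
case=> [i|j]; last exact: Pr.
by apply: span_pair (Pr (Ordinal n_gt0)); rewrite // setUC.
Qed.

Lemma strongly_RA_bipartite :
  0 < m -> 0 < n -> (m, n) <> (1, 1) -> coprime m n -> strongly_RA K.
Proof.
move=> m_gt0 n_gt0 neq11 co_mn; apply: strongly_RA_of_span.
pose span := int_span (@distinct_meet K).
pose i0 := Ordinal m_gt0; pose j0 := Ordinal n_gt0.
(* Modulo the edges, every left vertex is x and every right vertex is - x. *)
pose x := indic [set l i0].
have pair i j : span (indic [set l i; r j]).
  by rewrite -meet_lr; apply: span_nbhdI.
have pairD i j : span (indic [set l i] + indic [set r j])%R.
  by rewrite -indic_pair //; apply: pair.
have span_m : 1 < n -> span (x *+ m)%R.
  move=> n_gt1; have Pl : span (indic lside).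
    by rewrite -(@meet_rr j0 (Ordinal n_gt1)) //; apply: span_nbhdI.
  have -> : (x *+ m = indic lside - \sum_(i < m) (indic [set l i] - x))%R.
    by rewrite indic_lside sumrB opprB addrC subrK sumr_const card_ord.
  apply: spanB => //; apply: span_sum => i.
  rewrite -[(_ - _)%R](addrKA (indic [set r j0])) [X in (_ - X)%R]addrC.
  exact: spanB (pairD _ _) (pairD _ _).
have span_n : 1 < m -> span (x *+ n)%R.
  move=> m_gt1; have Pr : span (indic rside).
    by rewrite -(@meet_ll i0 (Ordinal m_gt1)) //; apply: span_nbhdI.
  have -> : (x *+ n = \sum_(j < n) (x + indic [set r j]) - indic rside)%R.
    by rewrite indic_rside big_split /= addrK sumr_const card_ord.
  by apply: spanB => //; apply: span_sum => j; apply: pairD.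
have span_x : span x.
  have [m_gt1|m_le1] := ltnP 1 m; last first.
    have m1 : m = 1 by lia.
    rewrite -[x]mulr1n -[X in (_ *+ X)%R]m1; apply: span_m.
    by rewrite ltnNge; apply/negP=> n_le1; apply: neq11; congr (_, _); lia.
  have [n_gt1|n_le1] := ltnP 1 n; last first.
    by rewrite -[x]mulr1n (_ : 1 = n); [exact: span_n|lia].
  by apply: (span_coprime m_gt0 co_mn); [exact: span_m|exact: span_n].
have span_r j : span (indic [set r j]).
  by apply: span_pair span_x; last exact: pair.
case=> [i|j]; last exact: span_r.
by apply: span_pair (span_r j0); rewrite // setUC; apply: pair.
Qed.

Lemma not_strongly_RA_bipartite :
  0 < m -> ~~ coprime m n -> ~ strongly_RA K.
Proof.
move=> m_gt0 not_co.
pose w (u : K) : int := if u is inl _ then 1%R else (-1)%R.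
refine (@not_strongly_RA_of_weight K w (gcdn m n) (l (Ordinal m_gt0)) _ _);
  last by rewrite dvdzE /= dvdn1.
have w_lside : (\sum_(u in lside) w u = m%:Z)%R.
  rewrite big_mkcond big_sumType /= [X in (_ + X)%R]big1 ?addr0.
    under eq_bigr => i _ do rewrite inE.
    by rewrite sumr_const card_ord natz.
  by move=> j _; rewrite inE.
have w_rside : (\sum_(u in rside) w u = - n%:Z)%R.
  rewrite big_mkcond big_sumType /= big1 ?add0r.
    under eq_bigr => i _ do rewrite inE.
    by rewrite sumr_const card_ord mulNrn natz.
  by move=> i _; rewrite inE.
have w_pair i j : (\sum_(u in [set l i; r j]) w u = 0)%R.
  by rewrite big_setU1 ?inE //= big_set1 subrr.
move=> S [[i|j] [[i'|j'] [neq_uv ->]]].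
- by rewrite meet_ll ?w_rside ?dvdzE ?abszN ?dvdn_gcdr.
- by rewrite meet_lr w_pair dvdz0.
- by rewrite setIC meet_lr w_pair dvdz0.
- by rewrite meet_rr ?w_lside ?dvdzE ?dvdn_gcdl.
Qed.

End Bipartite.

Theorem theorem5p18 :
  (RA (cycle_graph 4) /\ ~ strongly_RA (cycle_graph 4)) /\
  (forall m k : nat, 2 <= m -> 3 <= k -> strongly_RA (grid_graph m k)) /\
  (forall m n : nat, 1 <= m -> 1 <= n -> (m, n) <> (1, 1) ->
     RA (complete_bipartite m n) /\
     (strongly_RA (complete_bipartite m n) <-> coprime m n)).
Proof.
split; first by split; [exact: RA_C4|exact: not_strongly_RA_C4].
split=> [m k _|m n m_gt0 n_gt0 neq11]; first exact: strongly_RA_grid.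
split; first exact: RA_bipartite.
split=> [sRA|]; last exact: strongly_RA_bipartite.
by apply/negPn/negP=> /(not_strongly_RA_bipartite m_gt0).
Qed.
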